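(* Let $G$ be a graph isomorphic to $C(\pi)$ for some $\pi\in\mathcal{S}_n$. Then $G$ is isomorphic to $C(\sigma)$ for some $\sigma\in\mathcal{S}_n(132)$ if and only if $G$ does not contain the path $P_3$ (the path with $4$ vertices and $3$ edges) as an induced subgraph.
   Context: For $\pi=\pi_1\cdots\pi_n\in\mathcal{S}_n$, $C(\pi)$ is the simple graph on vertex set $\{1,\dots,n\}$ in which distinct $i,j$ are adjacent iff there exists $k$ with $k<i$, $k<j$, $\pi_k<\pi_i$ and $\pi_k<\pi_j$; equivalently, it is the competition graph of the digraph $D(\pi)$ on the points $(i,\pi_i)$ with an arc from $(j,\pi_j)$ to $(i,\pi_i)$ whenever $i<j$ and $\pi_i<\pi_j$. $\mathcal{S}_n(132)$ is the set of permutations in $\mathcal{S}_n$ with no subsequence order-isomorphic to $132$. *)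

(* Defs.v *)
From mathcomp Require Import all_boot all_fingroup.
Set Implicit Arguments.
Unset Strict Implicit.
Unset Printing Implicit Defensive.

Record sgraph := SGraph {
  vertex :> finType;
  adj : rel vertex;
  adj_sym : symmetric adj;
  adj_irrefl : irreflexive adj
}.

Definition isomorphic (G H : sgraph) : Prop :=
  exists f : G -> H, bijective f /\ {mono f : x y / adj x y}.

Definition induced_subgraph (H G : sgraph) : Prop :=
  exists f : H -> G, injective f /\ {mono f : x y / adj x y}.

Definition path_adj (m : nat) : rel 'I_m.+1 :=
  [rel i j : 'I_m.+1 | (i.+1 == j :> nat) || (j.+1 == i :> nat)].

Lemma path_adj_sym m : symmetric (@path_adj m).
Proof. by move=> i j; rewrite /path_adj /= orbC. Qed.

Lemma path_adj_irrefl m : irreflexive (@path_adj m).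
Proof. by move=> i; rewrite /path_adj /= orbb gtn_eqF. Qed.

(* The index counts edges: path_graph m has m.+1 vertices. *)
Definition path_graph (m : nat) : sgraph :=
  SGraph (@path_adj_sym m) (@path_adj_irrefl m).

(* Positions and values both range over {0, .., n-1} instead of {1, .., n}. *)
Definition comp_adj (n : nat) (pi : 'S_n) : rel 'I_n :=
  [rel i j : 'I_n | (i != j) &&
     [exists k : 'I_n, [&& k < i, k < j, pi k < pi i & pi k < pi j]]].

Lemma comp_adj_sym n (pi : 'S_n) : symmetric (comp_adj pi).
Proof.
move=> i j; rewrite /comp_adj /= eq_sym; congr (_ && _); apply: eq_existsb => k.
by rewrite andbCA; do 2 congr (_ && _); rewrite andbC.
Qed.

Lemma comp_adj_irrefl n (pi : 'S_n) : irreflexive (comp_adj pi).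
Proof. by move=> i; rewrite /comp_adj /= eqxx. Qed.

Definition comp_graph (n : nat) (pi : 'S_n) : sgraph :=
  SGraph (comp_adj_sym pi) (comp_adj_irrefl pi).

(* The word p is meant to have distinct letters; only their relative order
   matters. *)
Definition contains_pattern (n : nat) (pi : 'S_n) (p : seq nat) : Prop :=
  exists s : 'I_(size p) -> 'I_n,
    (forall a b : 'I_(size p), a < b -> s a < s b) /\
    forall a b : 'I_(size p), (pi (s a) < pi (s b)) = (nth 0 p a < nth 0 p b).

Definition avoids (n : nat) (pi : 'S_n) (p : seq nat) : Prop :=
  ~ contains_pattern pi p.

(* Main.v *)
Require Import Defs.
From mathcomp Require Import all_boot all_fingroup.
From mathcomp Require Import zify.
Set Implicit Arguments.
Unset Strict Implicit.
Unset Printing Implicit Defensive.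

(**
  In a 132-avoiding permutation the closed neighbourhoods of adjacent vertices
  are nested, which fails for the middle edge of an induced P_3.

  Conversely, the left-to-right minima of pi are isolated in C(pi), and the
  minima lying below and to the left of another vertex v form an interval
  [a v, b v] of consecutive minima; two non-minima are adjacent iff their
  intervals meet. If this interval graph has no induced P_3, then either some
  cut separates the intervals into two nonempty parts without being crossed, or
  some interval meets all the others. In the first case realize both parts,
  minima included, and place one above and to the left of the other; in the
  second case realize the rest and add one point above and to the right of
  everything. Both operations preserve 132-avoidance.
*)

(** * Point configurations *)

Section Configurations.

Variables (T : finType) (e : rel T).
Implicit Types (D : {set T}) (x y : T -> nat).

Definition common_lower D x y u v :=
  exists2 k, k \in D & [&& x k < x u, x k < x v, y k < y u & y k < y v].

Definition avoids132_on D x y := forall i j k, i \in D -> j \in D -> k \in D ->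
  x i < x j -> x j < x k -> y i < y k -> y k < y j -> False.

(* The relation e is allowed to hold on the diagonal: e u u says that u is not
   a left-to-right minimum. *)
Definition realizes D x y N := [/\
  {in D, forall u, x u < N /\ y u < N},
  {in D &, injective x}, {in D &, injective y},
  avoids132_on D x y &
  {in D &, forall u v, common_lower D x y u v <-> e u v}].

(** Coordinates are arbitrary naturals, so configurations can be translated and merged; the bound
    [N] tells where free space begins. *)
Definition realizable D := exists x y N, realizes D x y N.

(** Points on a descending line: none is below and to the left of another. *)
Lemma realizable_antichain D : {in D &, forall u v, ~~ e u v} -> realizable D.
Proof.
move=> eD.
have [r [inj [N bound]]] : exists r : T -> nat,
    injective r /\ exists N, forall u, r u < N.
  exists (fun u => enum_rank u : nat); split; last by exists #|T| => u; apply: ltn_ord.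
  by move=> u v /ord_inj/enum_rank_inj.
exists r, (fun u => N - r u), N.+1; split.
- by move=> u _; have := bound u; lia.
- by move=> u v _ _; apply: inj.
- move=> u v _ _ uv; apply: inj.
  by have := bound u; have := bound v; lia.
- by move=> i j k _ _ _; lia.
- move=> u v uD vD; split=> [[k _]|]; first lia.
  by rewrite (negPf (eD _ _ uD vD)).
Qed.

(** With [D1] above and to the left of [D2], points of different parts are incomparable. A common
    lower point, like the 1 of a 132, is below and to the left of two others, so all three lie in
    one part. *)
Lemma realizable_union D1 D2 : [disjoint D1 & D2] ->
  (forall u v, u \in D1 -> v \in D2 -> ~~ e u v && ~~ e v u) ->
  realizable D1 -> realizable D2 -> realizable (D1 :|: D2).
Proof.
move=> dis e12 [x1] [y1] [N1] [b1 ix1 iy1 a1 r1] [x2] [y2] [N2] [b2 ix2 iy2 a2 r2].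
pose x u := if u \in D1 then x1 u else N1 + x2 u.
pose y u := if u \in D1 then N2 + y1 u else y2 u.
have caseD u : u \in D1 :|: D2 ->
    [/\ u \in D1, x u = x1 u, y u = N2 + y1 u & x1 u < N1 /\ y1 u < N1] \/
    [/\ u \in D2, x u = N1 + x2 u, y u = y2 u & x2 u < N2 /\ y2 u < N2].
  rewrite /x /y inE; case: (boolP (u \in D1)) => [u1 _|_ /= u2].
    by left; split=> //; apply: b1.
  by right; split=> //; apply: b2.
exists x, y, (N1 + N2); split.
- by move=> u /caseD[] [_ -> ->]; lia.
- move=> u v /caseD[] [uD -> _ ub] /caseD[] [vD -> _ vb] uv; try lia.
    exact: ix1.
  by apply: ix2 => //; lia.
- move=> u v /caseD[] [uD _ -> ub] /caseD[] [vD _ -> vb] uv; try lia.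
    by apply: iy1 => //; lia.
  exact: iy2.
- move=> i j k /caseD[] [iD -> -> ib] /caseD[] [jD -> -> jb]
    /caseD[] [kD -> -> kb] h1 h2 h3 h4; try lia.
    by apply: (a1 i j k) => //; lia.
  by apply: (a2 i j k) => //; lia.
- move=> u v /caseD[] [uD xu yu ub] /caseD[] [vD xv yv vb].
  + rewrite -r1 //; split=> -[k kD kl].
      by case/caseD: kD => -[kD xk yk kb]; [exists k => //; lia | lia].
    exists k; first by rewrite inE kD.
    have kU : k \in D1 :|: D2 by rewrite inE kD.
    case/caseD: kU => -[kD' -> -> kb]; first lia.
    by have := disjointFr dis kD; rewrite kD'.
  + case/andP: (e12 u v uD vD) => /negPf-> _; split=> // -[k /caseD[] []]; lia.
  + case/andP: (e12 v u vD uD) => _ /negPf->; split=> // -[k /caseD[] []]; lia.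
  + rewrite -r2 //; split=> -[k kD kl].
      by case/caseD: kD => -[kD xk yk kb]; [lia | exists k => //; lia].
    exists k; first by rewrite inE kD orbT.
    have kU : k \in D1 :|: D2 by rewrite inE kD orbT.
    case/caseD: kU => -[kD' -> -> kb]; last lia.
    by have := disjointFl dis kD; rewrite kD'.
Qed.

(** Put at the corner [(N, N)], [w] is last and highest, so it takes part in no 132. A common lower
    point of [u] and [w] is then just a lower point of [u], and [m] is a lower point of [w]. *)
Lemma realizable_dominated D w m : w \notin D -> m \in D -> e w w ->
  {in D, forall u, e u w = e u u /\ e w u = e u u} ->
  realizable D -> realizable (w |: D).
Proof.
move=> wD mD eww ew [x0] [y0] [N] [b0 ix0 iy0 a0 r0].
pose x u := if u \in D then x0 u else N.
pose y u := if u \in D then y0 u else N.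
have caseD u : u \in w |: D ->
    [/\ u = w, x u = N & y u = N] \/
    [/\ u \in D, x u = x0 u, y u = y0 u & x0 u < N /\ y0 u < N].
  rewrite /x /y => /setU1P[->|uD]; first by left; rewrite (negPf wD).
  by right; rewrite uD; split=> //; apply: b0.
have inU k : k \in D -> k \in w |: D by move=> kD; rewrite inE kD orbT.
have selfP u : u \in D -> e u u ->
    exists2 k, k \in w |: D & [&& x k < x u, x k < N, y k < y u & y k < N].
  move=> uD /(r0 u u uD uD)[k kD kl]; exists k; first exact: inU.
  have := b0 k kD; have := b0 u uD; rewrite /x /y uD kD; lia.
have selfN u k : u \in D -> k \in w |: D -> x k < x u -> y k < y u -> e u u.
  move=> uD /caseD[] [kD xk yk]; have := b0 u uD; rewrite xk yk /x /y uD.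
    lia.
  move=> _ _ xl yl; apply/(r0 u u uD uD); by exists k => //; lia.
exists x, y, N.+1; split.
- by move=> u /caseD[] [_ -> ->]; lia.
- move=> u v /caseD[[-> -> _]|[uD -> _ ub]] /caseD[[-> -> _]|[vD -> _ vb]] //; try lia.
  exact: ix0.
- move=> u v /caseD[[-> _ ->]|[uD _ -> ub]] /caseD[[-> _ ->]|[vD _ -> vb]] //; try lia.
  exact: iy0.
- move=> i j k /caseD[[_ -> ->]|[iD -> -> ib]] /caseD[[_ -> ->]|[jD -> -> jb]]
    /caseD[[_ -> ->]|[kD -> -> kb]]; try lia.
  exact: a0.
- move=> u v /caseD[[-> xu yu]|[uD xu yu ub]] /caseD[[-> xv yv]|[vD xv yv vb]].
  + split=> // _; exists m; first exact: inU.
    by have := b0 m mD; rewrite xu yu /x /y mD; lia.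
  + rewrite (proj2 (ew v vD)); split=> [[k kD /and4P[_ ? _ ?]]|]; first exact: (selfN v k).
    by case/(selfP v vD)=> k kD ?; exists k => //; rewrite xu yu; lia.
  + rewrite (proj1 (ew u uD)); split=> [[k kD /and4P[? _ ? _]]|]; first exact: (selfN u k).
    by case/(selfP u uD)=> k kD ?; exists k => //; rewrite xv yv; lia.
  + rewrite -r0 //; split=> -[k kD kl].
      by case/caseD: kD => -[kD xk yk]; [lia | exists k => //; lia].
    by exists k; [exact: inU | rewrite xu xv yu yv /x /y kD].
Qed.

End Configurations.

(** * Interval graphs without induced P_3 *)

Section Intervals.

Variables (T : finType) (M : {set T}) (a b c : T -> nat).

Definition meets u v := (a u <= b v) && (a v <= b u).

Definition interval_rel : rel T := [rel u v | [&& u \notin M, v \notin M & meets u v]].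

Hypothesis P3_free : forall u0 u1 u2 u3,
  u0 \notin M -> u1 \notin M -> u2 \notin M -> u3 \notin M ->
  meets u0 u1 -> meets u1 u2 -> meets u2 u3 ->
  ~~ meets u0 u2 -> ~~ meets u0 u3 -> ~~ meets u1 u3 -> False.

(** [c] locates the members of [M] on the line. This is the invariant of the induction: intervals
    are nonempty, and a member of [M] is at hand to serve as [m] in [realizable_dominated]. *)
Definition pierced (D : {set T}) := forall v, v \in D -> v \notin M ->
  exists2 m, m \in D & m \in M /\ a v <= c m <= b v.

(** Greedy sweep from the left: [w] reaches farthest among the intervals starting no later than the
    first right end. If [w] does not meet everything, cut just after [w]; if that cut is crossed,
    cut just after [z], the farthest-reaching interval starting by [b w]. *)
Lemma dominating_or_cut (D : {set T}) v0 : pierced D -> v0 \in D -> v0 \notin M ->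
  (exists w, [/\ w \in D, w \notin M &
     forall v, v \in D -> v \notin M -> meets v w]) \/
  (exists t, [/\ forall v, v \in D -> v \notin M -> ~~ (a v < t <= b v),
     exists u, [/\ u \in D, u \notin M & b u < t] &
     exists u, [/\ u \in D, u \notin M & t <= a u]]).
Proof.
move=> pD v0D v0M.
have ab v : v \in D -> v \notin M -> a v <= b v.
  by move=> vD /(pD v vD)[m _ [_]]; lia.
have [u1 [u1D u1M] min1] : exists2 u, u \in D /\ u \notin M &
    forall v, v \in D -> v \notin M -> b u <= b v.
  have v0P : v0 \in D :\: M by rewrite inE v0M.
  case: (@arg_minnP _ v0 (mem (D :\: M)) b v0P) => u /setDP[uD uM] min.
  by exists u => // v vD vM; apply: min; apply/setDP.
have [u2 [u2D u2M] max2] : exists2 u, u \in D /\ u \notin M &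
    forall v, v \in D -> v \notin M -> a v <= a u.
  have v0P : v0 \in D :\: M by rewrite inE v0M.
  case: (@arg_maxnP _ v0 (mem (D :\: M)) a v0P) => u /setDP[uD uM] max.
  by exists u => // v vD vM; apply: max; apply/setDP.
have reach s v : v \in D -> v \notin M -> a v <= s ->
    exists w, [/\ w \in D, w \notin M, a w <= s, b v <= b w &
      forall z, z \in D -> z \notin M -> a z <= s -> b z <= b w].
  move=> vD vM av; pose Q := [set z in D :\: M | a z <= s].
  have vQ : v \in Q by rewrite !inE vD vM.
  case: (@arg_maxnP _ v (mem Q) b vQ) => w /setIdP[/setDP[wD wM] aw] max.
  exists w; split=> //; first exact: max.
  by move=> z zD zM az; apply: max; apply/setIdP; split=> //; apply/setDP.
have [w [wD wM aw bw maxw]] := reach (b u1) u1 u1D u1M (ab _ u1D u1M).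
(* Reaching from the first right end to the last left end means meeting every interval. *)
have [Aw|wA] := leqP (a u2) (b w).
  left; exists w; split=> // v vD vM; apply/andP; split.
    exact: leq_trans (max2 v vD vM) Aw.
  exact: leq_trans aw (min1 v vD vM).
right.
have [z0 /andP[/setDP[z0D z0M] /andP[az0 bz0]]|noZ] :=
    pickP (fun v => (v \in D :\: M) && (a v <= b w < b v)); last first.
  exists (b w).+1; split; last 2 first.
  - by exists u1.
  - by exists u2.
  by move=> v vD vM; have := noZ v; rewrite inE vD vM /= ltnS => ->.
have [z [zD zM az bz maxz]] := reach (b w) z0 z0D z0M az0.
have {}bz : b w < b z := leq_trans bz0 bz.
(* Otherwise [z] would have been a better choice than [w]. *)
have az1 : b u1 < a z.
  by rewrite ltnNge; apply: contraL bz => /(maxw z zD zM); rewrite -leqNgt.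
(* Here [u1], [w], [z], [y] would be an induced [P_3]. *)
have absurd y : y \in D -> y \notin M -> a y <= b z -> b w < a y -> a z <= b y -> False.
  move=> yD yM h1 h2 h3.
  have := ab _ u1D u1M; have := ab _ wD wM; have := ab _ zD zM; have := ab _ yD yM.
  move=> ay az' aw' au1.
  by apply: (P3_free u1M wM zM yM); rewrite /meets;
     move: aw bw az bz az1 h1 h2 h3 ay az' aw' au1; clear; lia.
have [Az|zA] := leqP (a u2) (b z).
  case: (absurd u2) => //.
  exact: leq_trans (max2 z zD zM) (ab _ u2D u2M).
exists (b z).+1; split; last 2 first.
- by exists u1; split=> //; apply: leq_ltn_trans bw (ltnW _).
- by exists u2.
move=> v vD vM; apply/negP=> /andP[av bv]; apply: (absurd v) => //.
  by rewrite ltnNge; apply: contraL bv => /(maxz v vD vM); rewrite -leqNgt.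
exact: leq_trans (ab _ zD zM) (ltnW bv).
Qed.

Lemma interval_realizable (D : {set T}) : pierced D -> realizable interval_rel D.
Proof.
have [s] := ubnP #|D|; elim: s D => // s IH D sD pD.
have [v0 /andP[v0D v0M]|noV] := pickP (fun v => (v \in D) && (v \notin M)); last first.
  apply: realizable_antichain => u v uD vD.
  by have := noV u; rewrite uD /= /interval_rel /= => ->.
have [[w [wD wM dom]]|[t [nocross [u1 [u1D u1M u1t]] [u2 [u2D u2M u2t]]]]] :=
  dominating_or_cut pD v0D v0M.
  rewrite -(setD1K wD); have [m mD [mM _]] := pD w wD wM.
  have mw : m != w by apply: contraNneq wM => <-.
  apply: (@realizable_dominated _ _ _ _ m).
  - by rewrite !inE eqxx.
  - by rewrite !inE mw.
  - by rewrite /interval_rel /= wM dom.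
  - move=> u /setD1P[_ uD]; rewrite /interval_rel /= wM.
    have [//|uM] := boolP (u \in M).
    have := dom u uD uM; have [m' _ [_]] := pD u uD uM.
    by rewrite /meets; clear; lia.
  - apply: IH.
      by move: sD; rewrite (cardsD1 w) wD; clear; lia.
    move=> v /setD1P[_ vD] vM; have [m' m'D [m'M am]] := pD v vD vM.
    exists m' => //; rewrite !inE m'D andbT.
    by apply: contraNneq wM => <-.
(* Members of [M] are sorted by [c], intervals by right end. As no interval crosses [t], its
   piercing point falls on the same side, so both parts stay pierced. *)
pose D1 := [set v in D | (if v \in M then c v else b v) < t].
have D1sub : D1 \subset D by apply/subsetP=> v; rewrite inE => /andP[].
have u1D1 : u1 \in D1 by rewrite inE u1D (negPf u1M).
have ab2 : a u2 <= b u2 by have [? _ [_ /andP[]]] := pD u2 u2D u2M; apply: leq_trans.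
have u2D1 : u2 \notin D1 by rewrite inE u2D (negPf u2M) /= -leqNgt (leq_trans u2t).
have <- : D1 :|: D :\: D1 = D by rewrite -{1}(setIidPr D1sub) setID.
have cD := cardsID D1 D; rewrite (setIidPr D1sub) in cD.
apply: realizable_union.
- by rewrite disjoint_sym disjoints_subset; apply/subsetP=> v; rewrite !inE => /andP[].
- move=> u v /setIdP[uD ut] /setDP[vD]; rewrite inE vD /= -leqNgt /interval_rel /=.
  case: (boolP (u \in M)) ut => [_ _|uM ut]; first by rewrite !andbF.
  case: (boolP (v \in M)) => [_ _|vM vt] //.
  by have := nocross v vD vM; move: ut vt; rewrite /meets /=; clear; lia.
- apply: IH.
    have : 0 < #|D :\: D1| by apply/card_gt0P; exists u2; rewrite inE u2D1.
    by move: sD cD; clear; lia.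
  move=> v /setIdP[vD vt] vM; have [m mD [mM am]] := pD v vD vM.
  by exists m => //; move: vt am; rewrite inE mD mM (negPf vM) /=; clear; lia.
- apply: IH.
    have : 0 < #|D1| by apply/card_gt0P; exists u1.
    by move: sD cD; clear; lia.
  move=> v /setDP[vD]; rewrite inE vD /= -leqNgt => vt vM.
  have [m mD [mM am]] := pD v vD vM; exists m => //.
  have := nocross v vD vM; move: vt am.
  by rewrite !inE mD mM (negPf vM) /=; clear; lia.
Qed.

End Intervals.

(** * Standardization *)

Lemma rank_perm n (f : 'I_n -> nat) : injective f ->
  exists s : 'S_n, forall u v, (s u < s v) = (f u < f v).
Proof.
move=> fI; pose L u := [set v | f v < f u].
have Lmono u v : f u < f v -> #|L u| < #|L v|.
  move=> uv; apply: proper_card; apply/properP; split.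
    by apply/subsetP=> z; rewrite !inE; lia.
  by exists u; rewrite !inE ?ltnn.
have Lle u : #|L u| < n.
  rewrite -[X in _ < X]card_ord -cardsT; apply: proper_card.
  by apply/properP; split; [exact: subsetT | exists u; rewrite !inE ?ltnn].
have Lcmp u v : (#|L u| < #|L v|) = (f u < f v).
  case: (ltngtP (f u) (f v)) => [/Lmono->//|/Lmono|/fI->]; last by rewrite ltnn.
  by lia.
have rI : injective (fun u => Ordinal (Lle u)).
  move=> u v [uv]; apply: fI.
  by have := Lcmp u v; have := Lcmp v u; rewrite uv ltnn; lia.
by exists (perm rI) => u v; rewrite !permE /= Lcmp.
Qed.

Lemma contains_132I n (pi : 'S_n) (i j k : 'I_n) :
  i < j -> j < k -> pi i < pi k -> pi k < pi j -> contains_pattern pi [:: 1; 3; 2].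
Proof.
move=> ij jk ik kj; exists (fun z => nth i [:: i; j; k] z); split.
  by case=> [[|[|[|//]]] ?] [[|[|[|//]]] ?] //= _; lia.
by case=> [[|[|[|//]]] ?] [[|[|[|//]]] ?] //=; rewrite ?ltnn; lia.
Qed.

Lemma contains_132E n (pi : 'S_n) : contains_pattern pi [:: 1; 3; 2] ->
  exists i j k : 'I_n, [/\ i < j, j < k, pi i < pi k & pi k < pi j].
Proof.
case=> s [sx sy].
have h0 : 0 < 3 by []. have h1 : 1 < 3 by []. have h2 : 2 < 3 by [].
exists (s (Ordinal h0)), (s (Ordinal h1)), (s (Ordinal h2)).
by split; rewrite ?sy //; apply: sx.
Qed.

Lemma realizable_perm n (e : rel 'I_n) : realizable e [set: 'I_n] ->
  exists2 sigma : 'S_n, avoids sigma [:: 1; 3; 2] &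
  exists2 f : 'I_n -> 'I_n, bijective f &
    forall u v, comp_adj sigma (f u) (f v) = (u != v) && e u v.
Proof.
case=> x [y] [N] [_ ix iy av re].
have injx : injective x by move=> u v; apply: ix; rewrite inE.
have injy : injective y by move=> u v; apply: iy; rewrite inE.
have [s sE] := rank_perm injx; have [t tE] := rank_perm injy.
(* The left factor acts first: [sigma] sends the horizontal rank of a point to its vertical rank. *)
pose sigma := (s^-1 * t)%g.
have sigE u : sigma (s u) = t u by rewrite permM permK.
exists sigma.
  move/contains_132E=> [i] [j] [k].
  rewrite -[i](permKV s) -[j](permKV s) -[k](permKV s) !sigE !sE !tE => -[].
  by apply: av; rewrite inE.
exists s; first exact: (Bijective (permK s) (permKV s)).
move=> u v; rewrite /comp_adj /= (inj_eq perm_inj); congr (_ && _).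
apply/existsP/idP => [[k]|].
  rewrite -[k](permKV s) !sigE !sE !tE => kl.
  by apply/re; rewrite ?inE //; exists (s^-1 k)%g; rewrite ?inE.
case/re; rewrite ?inE // => k _ kl; exists (s k).
by rewrite !sigE !sE !tE.
Qed.

(** * The two implications *)

Section LeftToRightMinima.

Variables (n : nat) (pi : 'S_n).

Definition lr_minima := [set m : 'I_n | [forall k : 'I_n, (k < m) ==> (pi m < pi k)]].

(** Left-to-right minima have decreasing values, so the value bound [pi v] fixes the left end of the
    interval of [v]. The weak inequality makes [v] itself an admissible default. *)
Definition first_lower (v : 'I_n) : 'I_n := [arg min_(k < v | pi k <= pi v) k].
(** The right end is fixed by position: the least value up to [v] sits at the last left-to-right
    minimum up to [v]. *)
Definition last_minimum (v : 'I_n) : 'I_n := [arg min_(k < v | k <= v) pi k].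

Lemma pi_eq (u v : 'I_n) : pi u = pi v :> nat -> u = v.
Proof. by move/ord_inj/perm_inj. Qed.

Lemma first_lowerP v : v \notin lr_minima ->
  [/\ first_lower v < v, pi (first_lower v) < pi v, first_lower v \in lr_minima &
      forall k : 'I_n, pi k < pi v -> first_lower v <= k].
Proof.
rewrite inE negb_forall => /existsP[k0]; rewrite negb_imply => /andP[k0v pk0].
rewrite /first_lower; case: arg_minnP => [|m mv mmin]; first exact: leqnn.
have mk0 : m <= k0 by apply: mmin; lia.
have mv' : m < v by lia.
have pmv : pi m < pi v.
  by rewrite ltn_neqAle mv andbT; apply: contraTneq mv' => /pi_eq->; rewrite ltnn.
split=> //; last by move=> k kv; apply: mmin; lia.
rewrite inE; apply/forallP=> k; apply/implyP=> km; rewrite ltnNge; apply/negP=> pk.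
by have := mmin k; lia.
Qed.

Lemma last_minimumP v : v \notin lr_minima ->
  last_minimum v < v /\ forall k : 'I_n, k < v -> pi (last_minimum v) <= pi k.
Proof.
rewrite inE negb_forall => /existsP[k0]; rewrite negb_imply => /andP[k0v pk0].
rewrite /last_minimum; case: arg_minnP => [|m mv mmin]; first exact: leqnn.
split; last by move=> k kv; apply: mmin; lia.
rewrite ltn_neqAle mv andbT; apply/eqP => /ord_inj mE; move: mmin; rewrite mE => mmin.
have /mmin h : k0 <= v by lia.
have /pi_eq k0E : pi k0 = pi v :> nat by lia.
by move: k0v; rewrite k0E ltnn.
Qed.

Lemma first_lower_le_last_minimum v : v \notin lr_minima ->
  first_lower v <= last_minimum v.
Proof.
move=> vM; have [lt1 lt2 _ min1] := first_lowerP vM.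
by have [_ min2] := last_minimumP vM; apply: min1; have := min2 _ lt1; lia.
Qed.

(** If the intervals meet, the later of the two left ends is a common lower point. Conversely, a
    common lower point of [z] and [z'] forces the value at [last_minimum z'] below [pi z], and
    [first_lower z] is the leftmost such position. *)
Lemma comp_adj_interval u v : comp_adj pi u v =
  (u != v) && interval_rel lr_minima first_lower last_minimum u v.
Proof.
rewrite /comp_adj /interval_rel /=; congr (_ && _).
have notM (k z : 'I_n) : k < z -> pi k < pi z -> z \notin lr_minima.
  by move=> kz pkz; rewrite inE negb_forall; apply/existsP; exists k; lia.
have le_ab (k z z' : 'I_n) : k < z -> k < z' -> pi k < pi z -> pi k < pi z' ->
    first_lower z <= last_minimum z'.
  move=> h1 h2 h3 h4; have [_ _ _ min1] := first_lowerP (notM _ _ h1 h3).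
  have [_ min2] := last_minimumP (notM _ _ h2 h4).
  by apply: min1; have := min2 _ h2; lia.
have below (z z' : 'I_n) : z \notin lr_minima -> z' \notin lr_minima ->
    first_lower z <= last_minimum z' -> first_lower z' <= first_lower z ->
    [/\ first_lower z < z, first_lower z < z', pi (first_lower z) < pi z &
        pi (first_lower z) < pi z'].
  move=> zM z'M h1 h2; have [f1 f2 fM _] := first_lowerP zM.
  have [g1 g2 _ _] := first_lowerP z'M; have [l1 _] := last_minimumP z'M.
  split=> //; first lia.
  (* The minimum [first_lower z] comes after [first_lower z'], so its value is smaller still and
     lies below [pi z']. *)
  have [/ord_inj<-//|ne] := eqVneq (first_lower z' : nat) (first_lower z).
  move: fM; rewrite inE => /forallP/(_ (first_lower z')); lia.
apply/existsP/and3P => [[k /and4P[h1 h2 h3 h4]]|[uM vM /andP[h1 h2]]].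
  split; [exact: (notM k)|exact: (notM k)|].
  by apply/andP; split; apply: (le_ab k).
have [le|/ltnW le] := leqP (first_lower v) (first_lower u).
  by exists (first_lower u); have := below u v uM vM h1 le => -[]; lia.
by exists (first_lower v); have := below v u vM uM h2 le => -[]; lia.
Qed.

End LeftToRightMinima.

Lemma path3_induced (G : sgraph) (u0 u1 u2 u3 : G) : uniq [:: u0; u1; u2; u3] ->
  adj u0 u1 -> adj u1 u2 -> adj u2 u3 ->
  ~~ adj u0 u2 -> ~~ adj u0 u3 -> ~~ adj u1 u3 -> induced_subgraph (path_graph 3) G.
Proof.
move=> us a01 a12 a23 /negPf n02 /negPf n03 /negPf n13.
exists (fun i : 'I_4 => nth u0 [:: u0; u1; u2; u3] i); split.
  move=> [i i4] [j j4] /= /eqP; rewrite nth_uniq // => /eqP ij.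
  exact: val_inj.
move=> i j; case: i => [[|[|[|[|//]]]] ?]; case: j => [[|[|[|[|//]]]] ?];
  rewrite /= ?adj_irrefl ?a01 ?a12 ?a23 ?n02 ?n03 ?n13 //;
  by rewrite adj_sym ?a01 ?a12 ?a23 ?n02 ?n03 ?n13.
Qed.

Lemma comp_graph_realizable n (pi : 'S_n) :
  ~ induced_subgraph (path_graph 3) (comp_graph pi) ->
  realizable (interval_rel (lr_minima pi) (first_lower pi) (last_minimum pi)) [set: 'I_n].
Proof.
(* Minima are located by their positions; each interval is pierced at its left end. *)
move=> noP; apply: (interval_realizable (c := @nat_of_ord n)); last first.
  move=> v _ vM; exists (first_lower pi v); first exact: in_setT.
  have [_ _ fM _] := first_lowerP vM; split=> //.
  by rewrite leqnn first_lower_le_last_minimum.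
move=> u0 u1 u2 u3 M0 M1 M2 M3 m01 m12 m23 n02 n03 n13; apply: noP.
pose I := meets (first_lower pi) (last_minimum pi).
have Isym u v : I u v = I v u by rewrite /I /meets andbC.
(* [meets] ignores equality of vertices, so distinctness has to be recovered from what each interval
   meets. *)
have ne u v z : I u z -> ~~ I v z -> u != v by move=> uz; apply: contraNneq => <-.
have adjE u v : u \notin lr_minima pi -> v \notin lr_minima pi -> u != v ->
    @adj (comp_graph pi) u v = I u v.
  by move=> uM vM uv; rewrite /= comp_adj_interval uv /interval_rel /= uM vM.
have Irefl u : u \notin lr_minima pi -> I u u.
  by move=> uM; rewrite /I /meets first_lower_le_last_minimum.
have d01 : u0 != u1 by rewrite eq_sym; apply: (ne _ _ u2).
have d02 : u0 != u2 by apply: contraNneq n02 => <-; apply: Irefl.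
have d03 : u0 != u3 by apply: contraNneq n03 => <-; apply: Irefl.
have d13 : u1 != u3 by apply: contraNneq n13 => <-; apply: Irefl.
have d12 : u1 != u2 by apply: (ne _ _ u0); rewrite Isym.
have d23 : u2 != u3 by apply: (ne _ _ u1); rewrite Isym.
apply: (@path3_induced (comp_graph pi) u0 u1 u2 u3); rewrite ?adjE //.
by rewrite /= !inE !negb_or d01 d02 d03 d12 d13 d23.
Qed.

Lemma avoids_132_P3_free n (sigma : 'S_n) : avoids sigma [:: 1; 3; 2] ->
  ~ induced_subgraph (path_graph 3) (comp_graph sigma).
Proof.
move=> av [f [fI fE]].
(* A lower point [k] of [u] and [v] with a descent from [u] to [v] would be a 132. So
   [sigma u < sigma v], and lower points of [u] are lower points of [v]. *)
have nested (u v z : 'I_n) : u < v -> comp_adj sigma u v -> comp_adj sigma u z ->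
    z != v -> comp_adj sigma v z.
  move=> uv /andP[_ /existsP[k /and4P[ku kv pku pkv]]].
  have puv : sigma u < sigma v.
    rewrite ltnNge leq_eqVlt negb_or; apply/andP; split.
      by apply: contraTneq uv => /pi_eq->; rewrite ltnn.
    by apply/negP=> pvu; apply: av; apply: (contains_132I ku uv).
  case/andP=> _ /existsP[l /and4P[lu lz plu plz]] zv; rewrite /comp_adj /= eq_sym zv.
  by apply/existsP; exists l; rewrite lz plz; lia.
have h0 : 0 < 4 by []. have h1 : 1 < 4 by []. have h2 : 2 < 4 by []. have h3 : 3 < 4 by [].
pose w0 : path_graph 3 := Ordinal h0. pose w1 : path_graph 3 := Ordinal h1.
pose w2 : path_graph 3 := Ordinal h2. pose w3 : path_graph 3 := Ordinal h3.
have a12 : comp_adj sigma (f w1) (f w2) := fE w1 w2.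
have a10 : comp_adj sigma (f w1) (f w0) := fE w1 w0.
have a23 : comp_adj sigma (f w2) (f w3) := fE w2 w3.
have a21 : comp_adj sigma (f w2) (f w1) := fE w2 w1.
have n20 : comp_adj sigma (f w2) (f w0) = false := fE w2 w0.
have n13 : comp_adj sigma (f w1) (f w3) = false := fE w1 w3.
(* Whichever middle vertex stands first, its outer neighbour would be adjacent to the other middle
   vertex. *)
case: (ltngtP (f w1 : 'I_n) (f w2 : 'I_n)) => [lt|lt|/ord_inj eq].
- by move: n20; rewrite (nested _ _ _ lt a12 a10) // (inj_eq fI).
- by move: n13; rewrite (nested _ _ _ lt a21 a23) // (inj_eq fI).
- by move: a12; rewrite eq /comp_adj /= eqxx.
Qed.

Lemma induced_isomorphic (H G G' : sgraph) : isomorphic G G' ->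
  induced_subgraph H G <-> induced_subgraph H G'.
Proof.
case=> f [[g fK gK] fE]; split=> -[h [hI hE]].
  exists (f \o h); split; first exact: inj_comp (can_inj fK) hI.
  by move=> x y /=; rewrite fE hE.
exists (g \o h); split; first exact: inj_comp (can_inj gK) hI.
by move=> x y /=; rewrite -fE !gK hE.
Qed.

Theorem mainTheorem6 (n : nat) (G : sgraph)
    (hG : exists pi : 'S_n, isomorphic G (comp_graph pi)) :
  (exists sigma : 'S_n,
     avoids sigma [:: 1; 3; 2] /\ isomorphic G (comp_graph sigma)) <->
  ~ induced_subgraph (path_graph 3) G.
Proof.
split=> [[sigma [av iso]] /(induced_isomorphic _ iso)|noP].
  exact: avoids_132_P3_free.
have [pi iso] := hG.
have /comp_graph_realizable/realizable_perm[sigma av [f fb fE]] :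
    ~ induced_subgraph (path_graph 3) (comp_graph pi).
  by move=> /(induced_isomorphic _ iso).
exists sigma; split=> //; have [g [gb gE]] := iso.
exists (f \o g); split; first exact: bij_comp.
by move=> x y; rewrite -gE /= fE comp_adj_interval.
Qed.
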